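(* Let $m,n\ge1$ and let $\lambda$ be any integer-valued function on the vertices of the quiver $A_m\otimes\hat A_{2n-1}$. Then for all $1\le r\le m$, $$\mathrm{SPEED}_r^{+}=\mathrm{SPEED}_{m+1-r}^{-}.$$
   Context: The vertices of $A_m\otimes\hat A_{2n-1}$ are $(i,j)$ with $1\le i\le m$, $j\in\mathbb{Z}/2n\mathbb{Z}$; the $r$-th affine slice is $\{(r,j):j\in\mathbb{Z}/2n\}$. Fix $c\in\{0,1\}$ and let $\epsilon_{(i,j)}\in\{0,1\}$, $\epsilon_{(i,j)}\equiv i+j+c\pmod2$. The tropical $T$-system with initial data $\lambda$ is the family of integers $\mathfrak{t}^\lambda_v(t)$, for vertices $v$ and $t\in\mathbb{Z}$ with $t+\epsilon_v$ even, determined by $\mathfrak{t}^\lambda_v(\epsilon_v)=\lambda(v)$ and $$\mathfrak{t}^\lambda_{(i,j)}(t+1)+\mathfrak{t}^\lambda_{(i,j)}(t-1)=\max\bigl(\mathfrak{t}^\lambda_{(i,j-1)}(t)+\mathfrak{t}^\lambda_{(i,j+1)}(t),\ \mathfrak{t}^\lambda_{(i-1,j)}(t)+\mathfrak{t}^\lambda_{(i+1,j)}(t)\bigr),$$ with $\mathfrak{t}^\lambda_{(0,j)}(t)=\mathfrak{t}^\lambda_{(m+1,j)}(t)=0$. It is known that for each $r$ there exist (unique) integers $\mathrm{SPEED}_r^+=\mathrm{SPEED}_r^+(\lambda)$ and $\mathrm{SPEED}_r^-=\mathrm{SPEED}_r^-(\lambda)$ such that for every vertex $v$ of the $r$-th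 slice (and $t+\epsilon_v$ even): $\mathfrak{t}^\lambda_v(t+2n)=\mathfrak{t}^\lambda_v(t)+2\,\mathrm{SPEED}_r^+$ for all $t\gg0$, and $\mathfrak{t}^\lambda_v(t-2n)=\mathfrak{t}^\lambda_v(t)+2\,\mathrm{SPEED}_r^-$ for all $t\ll0$. *)

(* Defs.v *)
From mathcomp Require Import all_boot all_order all_algebra.
Set Implicit Arguments.
Unset Strict Implicit.
Unset Printing Implicit Defensive.
Import Order.TTheory GRing.Theory Num.Theory.
Local Open Scope ring_scope.

(* A vertex of A_m (x) \hat A_{2n-1} is a pair (i, j) with 1 <= i <= m and
   j : 'Z_(2 * n).  Every statement below assumes 0 < n, so that 'Z_(2 * n) is
   Z/2nZ and the parity of the representative of j is the parity of j.
   The first coordinate is a plain nat, so that the indices 0 and m.+1 of the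
   boundary condition are available; values outside 0 <= i <= m.+1 are never
   used. *)

Definition eps (n : nat) (c : bool) (i : nat) (j : 'Z_(2 * n)) : nat :=
  odd (i + j + c).

Arguments eps : clear implicits.

(* T i j t is only meaningful at the times t with t + eps_(i,j) even. *)
Definition even_time (n : nat) (c : bool) (i : nat) (j : 'Z_(2 * n))
    (t : int) : bool :=
  (2 %| t + (eps n c i j)%:Z)%Z.

Arguments even_time : clear implicits.

(* The recurrence at (i, j) is imposed at those t for which t + 1 (hence also
   t - 1) is a time of (i, j); then t is a time of all neighbours of (i, j).
   For n = 1 the neighbours j - 1 and j + 1 coincide and count twice. *)
Record tropical_T_system (m n : nat) (c : bool)
    (lambda : nat -> 'Z_(2 * n) -> int)
    (T : nat -> 'Z_(2 * n) -> int -> int) : Prop := TropicalTSystem {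
  tropT_init : forall i j, (1 <= i <= m)%N ->
    T i j (eps n c i j)%:Z = lambda i j;
  tropT_bottom : forall j t, T 0%N j t = 0;
  tropT_top : forall j t, T m.+1 j t = 0;
  tropT_rec : forall i j t, (1 <= i <= m)%N -> even_time n c i j (t + 1) ->
    T i j (t + 1) + T i j (t - 1) =
      Num.max (T i (j - 1) t + T i (j + 1) t)
              (T i.-1 j t + T i.+1 j t)
}.

(* s is the (unique) integer SPEED_r^+, resp. SPEED_r^-, of the family T. *)
Definition is_speed_plus (n : nat) (c : bool)
    (T : nat -> 'Z_(2 * n) -> int -> int) (r : nat) (s : int) : Prop :=
  forall j, exists t0 : int, forall t : int, t0 <= t -> even_time n c r j t ->
    T r j (t + (2 * n)%N%:Z) = T r j t + 2 * s.

Definition is_speed_minus (n : nat) (c : bool)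
    (T : nat -> 'Z_(2 * n) -> int -> int) (r : nat) (s : int) : Prop :=
  forall j, exists t0 : int, forall t : int, t <= t0 -> even_time n c r j t ->
    T r j (t - (2 * n)%N%:Z) = T r j t + 2 * s.

(* Main.v *)
Require Import Defs.
From mathcomp Require Import all_boot all_order all_algebra zify.
Set Implicit Arguments.
Unset Strict Implicit.
Unset Printing Implicit Defensive.
Import Order.TTheory GRing.Theory Num.Theory.
Local Open Scope ring_scope.

(** Why the theorem is true.

    In the light-cone coordinates S i x y = T i (x - y) (x + y + i + c) the
    T-system becomes the tropical Dodgson recurrence, whose solutions over a
    field are the contiguous i x i minors, with top left corner (x, y), of a
    matrix of rank m + 1; this matrix is the table of pairings of two sequences
    of vectors, and the cyclic symmetry j = j + 2n is a monodromy operator M of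
    determinant 1. In a suitable basis M is a product of bidiagonal matrices
    with nonnegative entries, moving x up and y down. By LU factorization, the
    leading principal r-minor of a power of M is the growth of row r of S in
    the forward direction, while its trailing principal r-minor is, by
    complementation, the growth of row m + 1 - r in the backward direction.
    Both are entries of powers of the same nonnegative matrix, the r-th
    exterior power of M, and so grow at the same rate as soon as one can go
    from the first r indices to the last r indices and back.

    The proof below is the tropical shadow of this argument and uses only
    integers. An r-minor becomes a maximum over configurations of r particles
    at distinct sites among 1, ..., m + 1: an x-step takes the particles from
    (x + 1, y) to (x, y), each staying or moving up one site, a y-step takes
    them from (x, y) to (x, y + 1), each staying or moving down one site, and
    the weights are differences of values of S. The heart is [flip]: the
    tropical exchange relation of the bidiagonal matrices, as an inequality;
    an x-step followed by a y-step can be replaced by a y-step followed by an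
    x-step of no smaller total weight. Hence ([flip_rectangle]) x-steps can be
    moved after all y-steps.

    Apply this to one walk, with d = m + 1 - r: the r particles start at the
    lowest sites, climb to the highest sites, wait there during many x-steps
    and y-steps, and come down again. The waiting collects the backward growth
    of row d, the climb and the descent cost a bounded amount. After the
    rearrangement the y-steps come first, so that the particles can never leave
    the lowest sites, and the weight is exactly the forward growth of row r.
    This is [opposite_rows_bound]; it says that the backward speed of row d is
    at most the forward speed of row r. Reversing time exchanges the two kinds
    of speeds, so the same inequality for the reversed solution and the row d
    is the opposite one. *)

(** * The octahedron recurrence and its particle weights *)

(** The T-system in light-cone coordinates: x and y are shifted by the height i
    so that the two times at which the recurrence determines T at a vertex are
    opposite corners of a unit square. *)
Record octahedron_solution (m : nat) (S : nat -> int -> int -> int) : Prop :=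
  OctahedronSolution {
  oct_bottom : forall (x y : int), S 0%N x y = 0;
  oct_top : forall (x y : int), S m.+1 x y = 0;
  oct_rec : forall i (x y : int), (1 <= i <= m)%N ->
    S i (x + 1) (y + 1) + S i x y =
      Num.max (S i x (y + 1) + S i (x + 1) y)
              (S i.-1 (x + 1) (y + 1) + S i.+1 x y)
}.

Section Particles.

Variables (m r : nat) (S : nat -> int -> int -> int).
Hypothesis hS : octahedron_solution m S.

(** Diagonal entry of the bidiagonal matrix from (x + 1, y) to (x, y); the
    entries that move a particle up a site are normalized to 0. *)
Definition stay_x (i : nat) (x y : int) : int :=
  S i (x + 1) y + S i.-1 x y - S i x y - S i.-1 (x + 1) y.

(** Subdiagonal entry of the unitriangular matrix from (x, y) to (x, y + 1),
    meaningful for i > 1. *)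
Definition hop_y (i : nat) (x y : int) : int :=
  S i x y + S i.-2 x (y + 1) - S i.-1 x y - S i.-1 x (y + 1).

(** In the T-system each of the two diagonal entries at level i of a unit square
    is the maximum of this common term and of one entry [hop_y], except at the two ends. *)
Definition stay_core (i : nat) (x y : int) : int :=
  S i.-1 x (y + 1) + S i (x + 1) y - S i.-1 (x + 1) (y + 1) - S i x y.

Lemma stay_xE i (x y : int) : (1 <= i <= m)%N ->
  stay_x i x (y + 1) = Num.max (stay_core i x y) (hop_y i.+1 x y).
Proof.
move=> im; have := oct_rec hS x y im.
by rewrite /stay_x /stay_core /hop_y /=; lia.
Qed.

(** At the two extreme levels a zero boundary row makes the second term of the
    maximum disappear: no particle leaves the sites 1, ..., m + 1. *)
Lemma stay_x_top (x y : int) : stay_x m.+1 x (y + 1) = stay_core m.+1 x y.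
Proof. by rewrite /stay_x /stay_core /= !(oct_top hS); lia. Qed.

Lemma stay_xE_below i (x y : int) : (1 <= i <= m)%N ->
  stay_x i.+1 x y =
    Num.max (stay_core i.+1 x y) (hop_y i.+1 (x + 1) y).
Proof.
move=> im; have := oct_rec hS x y im.
by rewrite /stay_x /stay_core /hop_y /=; lia.
Qed.

Lemma stay_x_bottom (x y : int) : stay_x 1 x y = stay_core 1 x y.
Proof. by rewrite /stay_x /stay_core /= !(oct_bottom hS); lia. Qed.

Lemma hop_stay_exchange i (x y : int) :
  hop_y i.+1 (x + 1) y + stay_x i x (y + 1) = stay_x i.+1 x y + hop_y i.+1 x y.
Proof. by rewrite /stay_x /hop_y /=; lia. Qed.

Lemma hop_core_exchange i (x y : int) :
  hop_y i.+1 (x + 1) y + stay_core i x y = hop_y i.+1 x y + stay_core i.+1 x y.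
Proof. by rewrite /stay_core /hop_y /=; lia. Qed.

Lemma stay_core_le i (x y : int) : (1 <= i <= m.+1)%N ->
  stay_core i x y <= stay_x i x (y + 1).
Proof.
move=> im; case: (eqVneq i m.+1) => [->|ne]; first by rewrite stay_x_top.
by have := @stay_xE i x y; lia.
Qed.

(** * Configurations of particles and the exchange of two steps *)

(** Particle p sits at the site I p. Positions are functions on all of nat, read
    only below r, so that a configuration can be extended one particle at a
    time. *)
Definition config (I : nat -> nat) : Prop :=
  (forall p, (p < r)%N -> (1 <= I p <= m.+1)%N) /\
  (forall p, (p.+1 < r)%N -> (I p < I p.+1)%N).

Definition xstep (I J : nat -> nat) : Prop :=
  [/\ config I, config J & forall p, (p < r)%N -> J p = I p \/ J p = (I p).+1].

Definition ystep (I J : nat -> nat) : Prop :=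
  [/\ config I, config J & forall p, (p < r)%N -> J p = I p \/ I p = (J p).+1].

Definition xterm (x y : int) (I J : nat -> nat) p : int :=
  if J p == I p then stay_x (I p) x y else 0.

Definition yterm (x y : int) (I J : nat -> nat) p : int :=
  if J p == I p then 0 else hop_y (I p) x y.

(** What particle p gains when its route from I to J in a unit square goes
    through K' (y-step first) instead of K (x-step first). *)
Definition gain (x y : int) (I K J K' : nat -> nat) p : int :=
  (yterm (x + 1) y I K' p + xterm x (y + 1) K' J p)
  - (xterm x y I K p + yterm x y K J p).

Definition upd (K : nat -> nat) (q v : nat) : nat -> nat :=
  fun p => if p == q then v else K p.

(** The route K' is built particle by particle, from the lowest one. Movers have
    no choice and gain 0. A staying particle may wait at its site in both steps
    or take a detour through a neighbouring site: above it when the x-step comes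
    first, below it when the y-step comes first. In the direction proved here,
    - a detour above is replaced by waiting, which costs nothing because
      [stay_x] dominates [hop_y] there;
    - waiting whose weight is the [stay_core] term stays waiting;
    - waiting whose weight is the [hop_y] term becomes a detour below, unless
      the particle just below also waits and blocks the way. Then both wait, and
      the loss is paid by what the lower particle gained, thanks to
      [hop_core_exchange].
    The last clause of the conclusion is the reserve kept for that payment by a
    particle that waits on both routes. *)
Lemma flip_prefix (x y : int) I K J q : xstep I K -> ystep K J -> (q <= r)%N ->
  exists K' : nat -> nat,
   [/\ forall p, (p < q)%N -> [/\ (1 <= K' p)%N, K' p = I p \/ I p = (K' p).+1
                              & J p = K' p \/ J p = (K' p).+1],
       forall p, (p.+1 < q)%N -> (K' p < K' p.+1)%N,
       0 <= \sum_(p < q) gain x y I K J K' p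
     & forall p, q = p.+1 -> K p = I p -> J p = I p -> K' p = I p ->
         stay_x (I p) x (y + 1) - stay_core (I p) x y
           <= \sum_(p < q) gain x y I K J K' p].
Proof.
move=> [[Ib Ii] [Kb Ki] IK] [_ [Jb Ji] KJ].
elim: q => [|q IH] qr.
  by exists id; split=> //; rewrite big_ord0.
have [K' [hv hi h0 hl]] := IH (ltnW qr).
have {}Ib := Ib q qr; have {}Kb := Kb q qr; have {}Jb := Jb q qr.
have {}IKq := IK q qr; have {}KJq := KJ q qr.
set D := \sum_(p < q) _ in h0 hl.
(* It remains to choose the site v where the new particle passes; e is its
     gain, with the weights of the new route written out. *)
suff [v [v1 vI vJ vK [g0 gl]]] : exists v : nat, [/\ (1 <= v)%N,
    v = I q \/ I q = v.+1, J q = v \/ J q = v.+1,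
    (forall p, q = p.+1 -> (K' p < v)%N) &
    let e := (if v == I q then 0 else hop_y (I q) (x + 1) y)
      + (if J q == v then stay_x v x (y + 1) else 0)
      - (xterm x y I K q + yterm x y K J q) in
    0 <= D + e /\ (K q = I q -> J q = I q -> v = I q ->
      stay_x (I q) x (y + 1) - stay_core (I q) x y <= D + e)].
  have updq : upd K' q v q = v by rewrite /upd eqxx.
  have updN p : (p < q)%N -> upd K' q v p = K' p.
    by rewrite /upd; case: eqP => //; lia.
  exists (upd K' q v).
  have -> : \sum_(p < q.+1) gain x y I K J (upd K' q v) p =
      D + gain x y I K J (upd K' q v) q.
    rewrite big_ord_recr /=; congr (_ + _); apply: eq_bigr => p _.
    by rewrite /gain /yterm /xterm updN.
  have -> : gain x y I K J (upd K' q v) q =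
      (if v == I q then 0 else hop_y (I q) (x + 1) y)
      + (if J q == v then stay_x v x (y + 1) else 0)
      - (xterm x y I K q + yterm x y K J q).
    by rewrite /gain {1}/yterm {1}/xterm updq.
  split=> //.
  - move=> p pq; case: (eqVneq p q) => [->|ne]; first by rewrite updq.
    by rewrite updN; [apply: hv|]; lia.
  - move=> p pq; case: (eqVneq p.+1 q) => [e|ne].
      by rewrite e updq updN; [apply: vK|lia].
    by rewrite !updN; [apply: hi|..]; lia.
  - by move=> p [<-]; rewrite updq.
rewrite /xterm /yterm.
have prevI p : q = p.+1 -> (I p < I q)%N by move=> e; rewrite e; apply: Ii; lia.
have prevK p : q = p.+1 -> (K p < K q)%N by move=> e; rewrite e; apply: Ki; lia.
have prevJ p : q = p.+1 -> (J p < J q)%N by move=> e; rewrite e; apply: Ji; lia.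
have prev p : q = p.+1 -> (K' p <= I p)%N /\ (K' p <= J p)%N.
  by move=> e; have [] := hv p ltac:(lia); lia.
have part_le := @stay_core_le (I q) x y Ib.
have [stay|hop] := eqVneq (J q) (I q); last first.
  have [KI|KI] := eqVneq (K q) (I q); last first.
    (* A particle that moves up does so in the second step. *)
    exists (I q); split; try lia.
      by move=> p e; have := prev p e; have := prevI p e; lia.
    have -> : J q = K q by lia.
    by rewrite /= !eqxx (negbTE KI); lia.
  (* A particle that moves down does so in the first step. *)
  have Ie : I q = (J q).+1 by lia.
  exists (J q); split; try lia.
    by move=> p e; have := prev p e; have := prevJ p e; lia.
  have := hop_stay_exchange (J q) x y.
  rewrite /= KI eqxx (negbTE hop) !Ie; lia.
(* From here on the particle stays. First, the detour above. *)
have [KI|KI] := eqVneq (K q) (I q); last first.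
  exists (I q); split; try lia.
    by move=> p e; have := prev p e; have := prevI p e; lia.
  have KIe : K q = (I q).+1 by lia.
  have := @stay_xE (I q) x y.
  rewrite /= stay (eq_sym _ (K q)) (negbTE KI) eqxx KIe; lia.
(* There is no detour below the site 1. *)
have [first|Igt1] := leqP (I q) 1.
  have I1 : I q = 1%N by lia.
  exists (I q); split; try lia.
    by move=> p e; have := prev p e; have := prevI p e; lia.
  have := stay_x_bottom x y.
  rewrite /= KI stay eqxx !I1 in part_le *; lia.
have [i Ie] : exists i, I q = i.+1 by exists (I q).-1; lia.
have below := @stay_xE_below i x y.
have [gb|bg] := leP (hop_y (I q) (x + 1) y) (stay_core (I q) x y).
  exists (I q); split; try lia.
    by move=> p e; have := prev p e; have := prevI p e; lia.
  rewrite /= KI stay eqxx; rewrite !Ie in gb part_le Ib *; lia.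
have [free|blocked] : (forall p, q = p.+1 -> (K' p < i)%N) \/
    exists2 p, q = p.+1 & (i <= K' p)%N.
  case: (q) => [|p]; first by left.
  by case: (ltnP (K' p) i) => ?; [left=> _ [<-]|right; exists p].
  exists i; split; try lia.
    by move=> p e; have := free p e; lia.
  rewrite /= KI stay eqxx; rewrite !Ie in bg part_le Ib *.
  by rewrite (ltn_eqF (ltnSn i)) (gtn_eqF (ltnSn i)); lia.
(* The particle p below waits at the site i on both routes: K' p is at most
   I p, which is less than I q = i.+1, and J p and K p are squeezed likewise. *)
have [p e iK] := blocked.
have := prev p e; have := prevI p e; have := prevK p e; have := prevJ p e.
have pr : (p < r)%N by lia.
have := IK p pr; have := KJ p pr.
move=> hKJ hIK hJ hK hI hK'.
have Ip : I p = i by lia.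
have := hl p e; rewrite Ip => {}hl.
have {}hl := hl ltac:(lia) ltac:(lia) ltac:(lia).
exists (I q); split; try lia.
  by move=> p' e'; have := prev p' e'; have := prevI p' e'; lia.
have := hop_core_exchange i x y; have := @stay_xE i x y.
rewrite /= KI stay eqxx; rewrite !Ie in bg part_le Ib *; lia.
Qed.


Definition xweight (x y : int) (I J : nat -> nat) : int :=
  \sum_(p < r) xterm x y I J p.

Definition yweight (x y : int) (I J : nat -> nat) : int :=
  \sum_(p < r) yterm x y I J p.

(** The tropical form, for the r-th exterior powers, of one half of the relation
    between the two factorizations of the same matrix as a product of an upper
    and a lower bidiagonal one. *)
Lemma flip (x y : int) I K J : xstep I K -> ystep K J ->
  exists K', [/\ ystep I K', xstep K' J &
    xweight x y I K + yweight x y K J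
      <= yweight (x + 1) y I K' + xweight x (y + 1) K' J].
Proof.
move=> IK KJ; have [K' [hv hi h0 _]] := flip_prefix x y IK KJ (leqnn r).
have [cI _ _] := IK; have [_ cJ _] := KJ.
have cK' : config K'.
  split=> [p pr|]; last exact: hi.
  by have [] := hv p pr; have := cI.1 p pr; lia.
exists K'; split.
- by split=> // p pr; have [] := hv p pr; lia.
- by split=> // p pr; have [] := hv p pr; lia.
- by rewrite -subr_ge0 /xweight /yweight -!big_split -sumrB.
Qed.

(** * Walks and their rearrangement *)

(** A walk of k x-steps from (x + k, y, I) to (x, y, J), of total weight w. *)
Fixpoint xwalk (k : nat) (x y : int) (I J : nat -> nat) (w : int) : Prop :=
  if k is k'.+1 then
    exists K v, [/\ xwalk k' (x + 1) y I K v, xstep K J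
                  & w = v + xweight x y K J]
  else I = J /\ w = 0.

(** A walk of l y-steps from (x, y, I) to (x, y + l, J), of total weight w. *)
Fixpoint ywalk (l : nat) (x y : int) (I J : nat -> nat) (w : int) : Prop :=
  if l is l'.+1 then
    exists K v, [/\ ystep I K, ywalk l' x (y + 1) K J v
                  & w = yweight x y I K + v]
  else I = J /\ w = 0.

Lemma flip_row k (x y : int) I K J w : xwalk k x y I K w -> ystep K J ->
  exists K' v, [/\ ystep I K', xwalk k x (y + 1) K' J v
    & w + yweight x y K J <= yweight (x + k%:Z) y I K' + v].
Proof.
elim: k x K J w => [|k IH] x K J w /=.
  by move=> [-> ->] KJ; exists J, 0; rewrite add0r !addr0.
move=> [K0 [v0 [I0 st ->]]] KJ; have [K1 [h1 h2 h3]] := flip x y st KJ.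
have [K' [v [IK' walk le]]] := IH _ _ _ _ I0 h1.
exists K', (v + xweight x (y + 1) K1 J); split=> //; first by exists K1, v.
have -> : x + k.+1%:Z = x + 1 + k%:Z by lia.
lia.
Qed.

Lemma flip_rectangle k l (x y : int) I K J w1 w2 :
  xwalk k x y I K w1 -> ywalk l x y K J w2 ->
  exists K' v1 v2, [/\ ywalk l (x + k%:Z) y I K' v2,
    xwalk k x (y + l%:Z) K' J v1 & w1 + w2 <= v2 + v1].
Proof.
elim: l y I K w1 w2 => [|l IH] y I K w1 w2 /=.
  by move=> xw [<- ->]; exists I, w1, 0; rewrite !addr0 add0r.
move=> xw [K0 [v0 [st yw ->]]].
have [K1 [u1 [st1 xw1 le1]]] := flip_row xw st.
have [K' [v1 [v2 [yw2 xw2 le2]]]] := IH _ _ _ _ _ xw1 yw.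
exists K', v1, (yweight (x + k%:Z) y I K1 + v2); split.
- by exists K1, v2.
- by have -> : y + l.+1%:Z = y + 1 + l%:Z by lia.
- lia.
Qed.

(** * The climbing walk *)

(** The r particles at the consecutive sites s + 1, ..., s + r. *)
Definition stacked (s p : nat) : nat := (s + p).+1.

Lemma stacked_config s : (s + r <= m.+1)%N -> config (stacked s).
Proof. by move=> sr; split=> p pr; rewrite /stacked; lia. Qed.

(** The diagonal entries at consecutive sites telescope: this is how the values
    of S come back from the weights. *)
Lemma sum_stay_x s q (x y : int) :
  \sum_(p < q) stay_x (stacked s p) x y =
    (S (s + q)%N (x + 1) y - S (s + q)%N x y) - (S s (x + 1) y - S s x y).
Proof.
elim: q => [|q IH]; first by rewrite big_ord0 addn0 subrr.
by rewrite big_ord_recr IH /stacked /stay_x addnS /=; lia.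
Qed.

Lemma xweight_stacked s (x y : int) :
  xweight x y (stacked s) (stacked s) =
    (S (s + r)%N (x + 1) y - S (s + r)%N x y) - (S s (x + 1) y - S s x y).
Proof.
rewrite -sum_stay_x; apply: eq_bigr => p _.
by rewrite /xterm eqxx.
Qed.

Lemma config_ge I p : config I -> (p < r)%N -> (p < I p)%N.
Proof.
move=> [Ib Ii]; elim: p => [|p IH] pr; first by have := Ib _ pr; lia.
by have := Ii _ pr; have := IH (ltnW pr); lia.
Qed.

(** Equality with [stacked 0] on the r particles only: the end of a walk is known
    as a function, but its intermediate configurations only on the particles. *)
Definition ground (I : nat -> nat) : Prop := forall p, (p < r)%N -> I p = p.+1.

(** No y-step is possible downwards from the lowest configuration. *)
Lemma ywalk_ground l (x y : int) I J w :
  ywalk l x y I J w -> ground I -> ground J /\ w = 0.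
Proof.
elim: l y I w => [|l IH] y I w /=; first by move=> [<- ->].
move=> [K [v [[cI cK st] yw ->]]] gI.
have KI p : (p < r)%N -> K p = I p.
  move=> pr; have := config_ge cK pr; have := gI _ pr.
  by have := st _ pr; lia.
have gK : ground K by move=> p pr; rewrite KI // gI.
have [gJ ->] := IH _ _ _ yw gK; split=> //.
by rewrite addr0 /yweight big1 // => p _; rewrite /yterm KI // eqxx.
Qed.

(** The particles only move up in x-steps, so a walk that ends in the lowest
    configuration never left it. *)
Lemma xwalk_ground k (x y : int) I J w :
  xwalk k x y I J w -> ground J -> w = S r (x + k%:Z) y - S r x y.
Proof.
elim: k x J w => [|k IH] x J w /=; first by move=> [_ ->] _; rewrite addr0 subrr.
move=> [K [v [xw [cK cJ st] ->]]] gJ.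
have gK : ground K.
  move=> p pr; have := config_ge cK pr; have := gJ _ pr.
  by have := st _ pr; lia.
rewrite (IH _ _ _ xw gK).
have -> : xweight x y K J = xweight x y (stacked 0) (stacked 0).
  by apply: eq_bigr => p _; rewrite /xterm gK // gJ.
rewrite xweight_stacked !add0n !(oct_bottom hS).
have -> : x + k.+1%:Z = x + 1 + k%:Z by lia.
lia.
Qed.

Lemma xstep_stacked s : (s + r <= m)%N -> xstep (stacked s) (stacked s.+1).
Proof.
by move=> sr; split; [apply: stacked_config; lia..|move=> p _; right].
Qed.

Lemma ystep_stacked s : (s + r <= m)%N -> ystep (stacked s.+1) (stacked s).
Proof.
by move=> sr; split; [apply: stacked_config; lia..|move=> p _; right].
Qed.

Lemma xwalk_climb s (x y : int) : (s + r <= m.+1)%N ->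
  xwalk s x y (stacked 0) (stacked s) 0.
Proof.
elim: s x => [|s IH] x sr //=.
exists (stacked s), 0; split; [by apply: IH; lia|exact: xstep_stacked|].
by rewrite add0r /xweight big1 // => p _; rewrite /xterm /stacked; case: eqP => //; lia.
Qed.

Lemma ywalk_descend s (x y : int) : (s + r <= m.+1)%N ->
  exists w, ywalk s x y (stacked s) (stacked 0) w.
Proof.
elim: s y => [|s IH] y sr /=; first by exists 0.
have [|w hw] := IH (y + 1); first by lia.
exists (yweight x y (stacked s.+1) (stacked s) + w), (stacked s), w.
by split=> //; exact: ystep_stacked.
Qed.

(** The hypothesis is wanted at every x0 because the waiting steps, which come
    after the walk of k steps, push its starting abscissa away. *)
Lemma xwalk_stay N s k (x y : int) I w : (s + r <= m.+1)%N ->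
  (forall x0 : int, xwalk k x0 y I (stacked s) w) ->
  xwalk (N + k) x y I (stacked s)
    (w + ((S (s + r)%N (x + N%:Z) y - S (s + r)%N x y)
       - (S s (x + N%:Z) y - S s x y))).
Proof.
move=> sr xw; elim: N x => [|N IH] x /=.
  by rewrite addr0 !subrr addr0; exact: xw.
have st := stacked_config sr.
eexists; eexists; split; [exact: IH|by split=> // p _; left|].
rewrite xweight_stacked.
have -> : x + N.+1%:Z = x + 1 + N%:Z by lia.
lia.
Qed.

Lemma ywalk_stay M s l (x y : int) J w : (s + r <= m.+1)%N ->
  ywalk l x (y + M%:Z) (stacked s) J w -> ywalk (M + l) x y (stacked s) J w.
Proof.
move=> sr; elim: M y => [|M IH] y /=; first by rewrite addr0.
have -> : y + M.+1%:Z = y + 1 + M%:Z by lia.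
move=> yw; exists (stacked s), w; split; [|exact: IH|].
  by have := stacked_config sr; split=> // p _; left.
by rewrite /yweight big1 ?add0r // => p _; rewrite /yterm eqxx.
Qed.

(** Compares the backward growth of row d with the forward growth of row r,
    uniformly in the size of the rectangle; C is the weight of the descent, which
    takes place in a fixed region. *)
Lemma opposite_rows_bound (x y : int) : (r <= m)%N ->
  let d := (m.+1 - r)%N in
  exists C, forall N M : nat,
    S d x (y - M%:Z) - S d (x + N%:Z) (y - M%:Z) + C <=
    S r (x + (N + d)%N%:Z) (y + d%:Z) - S r x (y + d%:Z).
Proof.
move=> rm d; have dr : (d + r = m.+1)%N by rewrite /d; lia.
have drm : (d + r <= m.+1)%N by rewrite dr.
have [C down] := ywalk_descend x y drm.
exists C => N M; set Y := y - M%:Z.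
have up := xwalk_stay N x drm (fun x0 => xwalk_climb x0 Y drm).
have {}down : ywalk (M + d) x Y (stacked d) (stacked 0) C.
  apply: ywalk_stay => //.
  by have -> : Y + M%:Z = y by rewrite /Y; lia.
have [K [v1 [v2 [yw xw le]]]] := flip_rectangle up down.
have [gK v20] := ywalk_ground yw (fun p _ => erefl).
have v1E := xwalk_ground xw (fun p _ => erefl).
move: le; rewrite v20 v1E dr !(oct_top hS).
have -> : Y + (M + d)%N%:Z = y + d%:Z by rewrite /Y; lia.
lia.
Qed.

End Particles.

(** * Comparison of the speeds *)

Definition linear_growth (f : nat -> int) (s : int) : Prop :=
  exists C k0, forall k : nat, (k0 <= k)%N -> f k = C + 2 * s * k%:Z.

Lemma period_iter (S : nat -> int -> int -> int) P i (x y : int) k :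
  (forall i (x y : int), S i (x + P%:Z) (y - P%:Z) = S i x y) ->
  S i (x + (P * k)%N%:Z) (y - (P * k)%N%:Z) = S i x y.
Proof.
move=> per; elim: k => [|k IH]; first by rewrite muln0 addr0 subr0.
rewrite -[RHS]IH -[RHS]per.
by congr (S i _ _); rewrite mulnS; lia.
Qed.

Lemma growth_opposite_rows_le m P r S s s' :
  octahedron_solution m S ->
  (forall i (x y : int), S i (x + P%:Z) (y - P%:Z) = S i x y) ->
  (r <= m)%N ->
  (forall x y : int, linear_growth (fun k => S r (x + (P * k)%N%:Z) y) s) ->
  (forall x y : int,
     linear_growth (fun k => S (m.+1 - r)%N (x - (P * k)%N%:Z) y) s') ->
  s' <= s.
Proof.
move=> hS per rm gp gm; set d := (m.+1 - r)%N in gm.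
(* Both sides of the bound grow linearly in k, with slopes 2 s' and 2 s. *)
have [C bound] := opposite_rows_bound hS 0 0 rm.
have [Cp [kp hp]] := gp d%:Z d%:Z; have [Cm [km hm]] := gm 0 0.
pose B := S d 0 0 - C + Cp - S r 0 d%:Z - Cm.
pose k := (kp + km + `|B| + 1)%N.
have := bound (P * k)%N (P * k)%N; rewrite -/d period_iter //.
have -> : S d 0 (0 - (P * k)%N%:Z) = S d (0 - (P * k)%N%:Z) 0.
  by rewrite -(period_iter d (0 - (P * k)%N%:Z) 0 k per); congr (S d _ _); lia.
have -> : 0 + (P * k + d)%N%:Z = d%:Z + (P * k)%N%:Z by lia.
rewrite hm ?hp ?add0r; [|rewrite /k; lia..] => le.
rewrite leNgt; apply/negP => lt.
have : 2 * (s' - s) * k%:Z <= B by rewrite /B; lia.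
have kB : B < k%:Z by rewrite /k; lia.
have : k%:Z <= (s' - s) * k%:Z by rewrite ler_peMl //; lia.
lia.
Qed.

(** The reversal t -> -t fixes the coordinate j = x - y; as t = x + y + i, up to a
    constant, it exchanges x and -y - i. *)
Definition time_reversal (S : nat -> int -> int -> int) : nat -> int -> int -> int :=
  fun i (x y : int) => S i (- y - i%:Z) (- x - i%:Z).

Lemma time_reversal_solution m S :
  octahedron_solution m S -> octahedron_solution m (time_reversal S).
Proof.
move=> hS; split=> [x y|x y|i x y im]; rewrite /time_reversal.
- exact: (oct_bottom hS).
- exact: (oct_top hS).
have := oct_rec hS (- y - i%:Z - 1) (- x - i%:Z - 1) im.
have -> : - y - i%:Z - 1 + 1 = - y - i%:Z by lia.
have -> : - x - i%:Z - 1 + 1 = - x - i%:Z by lia.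
have -> : - (y + 1) - i%:Z = - y - i%:Z - 1 by lia.
have -> : - (x + 1) - i%:Z = - x - i%:Z - 1 by lia.
have -> : - (y + 1) - i.-1%:Z = - y - i%:Z by lia.
have -> : - (x + 1) - i.-1%:Z = - x - i%:Z by lia.
have -> : - y - i.+1%:Z = - y - i%:Z - 1 by lia.
have -> : - x - i.+1%:Z = - x - i%:Z - 1 by lia.
by lia.
Qed.

(** * From the T-system to light-cone coordinates *)

Section LightCone.

Variables (n : nat) (hn : (1 <= n)%N) (c : bool).
Variable T : nat -> 'Z_(2 * n) -> int -> int.

Definition light_cone (i : nat) (x y : int) : int :=
  T i (x - y)%:~R (x + y + i%:Z + c%:Z).

Lemma modulus_gt1 : (1 < 2 * n)%N. Proof. by lia. Qed.

(** The parity of a residue modulo 2n is well defined. It is what makes every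
    point (i, x, y) correspond to a meaningful time. *)
Lemma nat_of_intr_parity (z : int) :
  (2 %| (nat_of_ord (z%:~R : 'Z_(2 * n)))%:Z - z)%Z.
Proof.
have n2 := modulus_gt1.
have natE (k : nat) : (2 %| (nat_of_ord (k%:R : 'Z_(2 * n)))%:Z - k%:Z)%Z.
  rewrite val_Zp_nat //.
  have := divn_eq k (2 * n); set q := (k %/ _)%N; set v := (k %% _)%N => ->.
  have -> : (q * (2 * n) = 2 * (q * n))%N by lia.
  lia.
case: z => [k|k]; first exact: natE.
(* -(k+1) is congruent to the natural number (k+1) * (2n-1). *)
have -> : (Negz k)%:~R = ((k.+1 * (2 * n).-1)%N)%:R :> 'Z_(2 * n).
  rewrite NegzE mulrNz -pmulrn natrM -subn1 natrB; last by lia.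
  by rewrite pchar_Zp // sub0r mulrN1.
have := natE (k.+1 * (2 * n).-1)%N; set v := nat_of_ord _.
have -> : (k.+1 * (2 * n).-1 = 2 * (k.+1 * n.-1) + k.+1)%N.
  by rewrite -[in LHS](prednK hn); lia.
by rewrite NegzE; lia.
Qed.

Lemma even_time_light_cone i (x y : int) :
  even_time n c i (x - y)%:~R (x + y + i%:Z + c%:Z).
Proof.
rewrite /even_time /eps; have := nat_of_intr_parity (x - y).
set v := nat_of_ord _; lia.
Qed.

Lemma intr_modulus (z : int) k :
  (z + (2 * n * k)%N%:Z)%:~R = z%:~R :> 'Z_(2 * n).
Proof. by rewrite intrD -pmulrn natrM (pchar_Zp modulus_gt1) mul0r addr0. Qed.

Lemma light_cone_octahedron m lambda :
  tropical_T_system m c lambda T -> octahedron_solution m light_cone.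
Proof.
move=> hT; split=> [x y|x y|i x y im]; rewrite /light_cone.
- exact: (tropT_bottom hT).
- exact: (tropT_top hT).
pose t : int := x + y + i%:Z + c%:Z + 1.
have et : even_time n c i (x - y)%:~R (t + 1).
  have := even_time_light_cone i (x + 1) (y + 1).
  have -> : x + 1 - (y + 1) = x - y by lia.
  by have -> : x + 1 + (y + 1) + i%:Z + c%:Z = t + 1 by rewrite /t; lia.
have j0 : x + 1 - (y + 1) = x - y by lia.
have jm : (x - (y + 1))%:~R = (x - y)%:~R - 1 :> 'Z_(2 * n).
  by rewrite (_ : x - (y + 1) = x - y + (-1)); [exact: intrD|lia].
have jp : (x + 1 - y)%:~R = (x - y)%:~R + 1 :> 'Z_(2 * n).
  by rewrite (_ : x + 1 - y = x - y + 1); [exact: intrD|lia].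
have := tropT_rec hT im et; rewrite j0 jm jp.
have -> : x + 1 + (y + 1) + i%:Z + c%:Z = t + 1 by rewrite /t; lia.
have -> : x + y + i%:Z + c%:Z = t - 1 by rewrite /t; lia.
have -> : x + (y + 1) + i%:Z + c%:Z = t by rewrite /t; lia.
have -> : x + 1 + y + i%:Z + c%:Z = t by rewrite /t; lia.
have -> : x + 1 + (y + 1) + i.-1%:Z + c%:Z = t by rewrite /t; lia.
by have -> : x + y + i.+1%:Z + c%:Z = t by rewrite /t; lia.
Qed.

Lemma light_cone_periodic i (x y : int) :
  light_cone i (x + (2 * n)%N%:Z) (y - (2 * n)%N%:Z) = light_cone i x y.
Proof.
rewrite /light_cone.
have -> : x + (2 * n)%N%:Z - (y - (2 * n)%N%:Z) = x - y + (2 * n * 2)%N%:Z.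
  by lia.
by rewrite intr_modulus; congr (T _ _ _); lia.
Qed.

(** Moving x by 2nk does not change j and moves the time by 2nk. *)
Lemma light_cone_growth_plus r s (x y : int) : is_speed_plus c T r s ->
  linear_growth (fun k => light_cone r (x + (2 * n * k)%N%:Z) y) s.
Proof.
move=> sp; have [t0 ht0] := sp (x - y)%:~R.
pose t : int := x + y + r%:Z + c%:Z.
pose f k := T r (x - y)%:~R (t + (2 * n * k)%N%:Z).
have fE k : light_cone r (x + (2 * n * k)%N%:Z) y = f k.
  rewrite /light_cone /f.
  have -> : x + (2 * n * k)%N%:Z - y = x - y + (2 * n * k)%N%:Z by lia.
  by rewrite intr_modulus; congr (T _ _ _); rewrite /t; lia.
have step k : (`|t0 - t| <= k)%N -> f k.+1 = f k + 2 * s.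
  move=> tk; rewrite /f -ht0; first by congr (T _ _ _); rewrite mulnS; lia.
    have : (k <= 2 * n * k)%N by rewrite leq_pmull; lia.
    lia.
  have := even_time_light_cone r x y; rewrite -/t /even_time.
  have -> : (2 * n * k = 2 * (n * k))%N by lia.
  lia.
exists (f `|t0 - t|%N - 2 * s * `|t0 - t|%N%:Z), `|t0 - t|%N => k.
move=> /subnK <-; rewrite fE; elim: (k - _)%N => [|l IH].
  by rewrite add0n subrK.
by rewrite addSn step ?leq_addl // IH intS mulrDr mulr1; lia.
Qed.

Lemma light_cone_growth_minus r s (x y : int) : is_speed_minus c T r s ->
  linear_growth (fun k => light_cone r (x - (2 * n * k)%N%:Z) y) s.
Proof.
move=> sp; have [t0 ht0] := sp (x - y)%:~R.
pose t : int := x + y + r%:Z + c%:Z.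
pose f k := T r (x - y)%:~R (t - (2 * n * k)%N%:Z).
have fE k : light_cone r (x - (2 * n * k)%N%:Z) y = f k.
  rewrite /light_cone /f -(intr_modulus _ k).
  by congr (T _ _%:~R _); rewrite /t; lia.
have step k : (`|t0 - t| <= k)%N -> f k.+1 = f k + 2 * s.
  move=> tk; rewrite /f -ht0; first by congr (T _ _ _); rewrite mulnS; lia.
    have : (k <= 2 * n * k)%N by rewrite leq_pmull; lia.
    lia.
  have := even_time_light_cone r x y; rewrite -/t /even_time.
  have -> : (2 * n * k = 2 * (n * k))%N by lia.
  lia.
exists (f `|t0 - t|%N - 2 * s * `|t0 - t|%N%:Z), `|t0 - t|%N => k.
move=> /subnK <-; rewrite fE; elim: (k - _)%N => [|l IH].
  by rewrite add0n subrK.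
by rewrite addSn step ?leq_addl // IH intS mulrDr mulr1; lia.
Qed.

End LightCone.

Theorem theorem4p3p1 (m n : nat) (hm : (1 <= m)%N) (hn : (1 <= n)%N) (c : bool)
    (lambda : nat -> 'Z_(2 * n) -> int)
    (T : nat -> 'Z_(2 * n) -> int -> int)
    (hT : tropical_T_system m c lambda T)
    (speed_plus speed_minus : nat -> int)
    (hplus : forall r : nat, (1 <= r <= m)%N ->
       is_speed_plus c T r (speed_plus r))
    (hminus : forall r : nat, (1 <= r <= m)%N ->
       is_speed_minus c T r (speed_minus r)) :
  forall r : nat, (1 <= r <= m)%N ->
    speed_plus r = speed_minus (m + 1 - r)%N.
Proof.
move=> r rm; rewrite addn1; set d := (m.+1 - r)%N.
have dm : (1 <= d <= m)%N by rewrite /d; lia.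
have dK : (m.+1 - d = r)%N by rewrite /d; lia.
have hS := light_cone_octahedron hn hT.
have per := light_cone_periodic hn c T.
apply/eqP; rewrite eq_le; apply/andP; split.
  (* Forward rows of the reversed solution are backward rows of T. *)
  apply: (growth_opposite_rows_le (P := (2 * n)%N) (r := d)
            (time_reversal_solution hS)).
  - by move=> i x y; rewrite /time_reversal -[RHS]per; congr light_cone; lia.
  - by lia.
  - move=> x y; have [C [k0 hC]] :=
      light_cone_growth_minus hn (- y - d%:Z) (- x - d%:Z) (hminus _ dm).
    exists C, k0 => k /hC <-; rewrite /time_reversal.
    by rewrite -[RHS](period_iter _ _ _ k per); congr light_cone; lia.
  - rewrite dK => x y; have [C [k0 hC]] :=
      light_cone_growth_plus hn (- y - r%:Z) (- x - r%:Z) (hplus _ rm).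
    exists C, k0 => k /hC <-; rewrite /time_reversal.
    by rewrite -[LHS](period_iter _ _ _ k per); congr light_cone; lia.
apply: (growth_opposite_rows_le (P := (2 * n)%N) (r := r) hS per).
- by lia.
- by move=> x y; exact: light_cone_growth_plus (hplus _ rm).
- by move=> x y; exact: light_cone_growth_minus (hminus _ dm).
Qed.
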